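(* Let $k\ge1$ be a natural number and let $B_k=(V,E)$ be the generalized Bratteli diagram with $V_n=\mathbb Z$ for all $n\ge0$, in which there is exactly one edge between $w\in V_n$ and $v\in V_{n+1}$ if $|v-w|\le k$, and no edge otherwise. Then there is no probability tail invariant measure on (the path space of) $B_k$.
   Context: The path space $X_{B_k}$ is the set of infinite paths (concatenated sequences of edges $x_n$ between $V_n$ and $V_{n+1}$, $n\ge0$) starting at $V_0$, with topology generated by cylinder sets (sets of infinite paths with a prescribed finite initial path starting in $V_0$). A Borel measure on $X_{B_k}$ is tail invariant if it takes equal values on the cylinder sets of any two finite paths starting in $V_0$ with the same terminal vertex. *)

(* Defs.v *)
From HB Require Import structures.
From mathcomp Require Import all_boot all_order all_algebra.
From mathcomp Require Import zify.
From mathcomp Require Import all_classical all_reals all_analysis.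

Set Implicit Arguments.
Unset Strict Implicit.
Unset Printing Implicit Defensive.

Import Order.TTheory GRing.Theory Num.Theory.

Local Open Scope classical_set_scope.
Local Open Scope ring_scope.

(* The n-th edge set E_n joins V_n to V_{n+1}, via the source map s and the
   range map r. *)
Record bratteli := Bratteli {
  vertex : nat -> Type ;
  edge : nat -> Type ;
  src : forall n, edge n -> vertex n ;
  rng : forall n, edge n -> vertex n.+1 ;
  vertex_countable : forall n, countable [set: vertex n] ;
  vertex_infinite : forall n, infinite_set [set: vertex n] ;
  edge_countable : forall n, countable [set: edge n] ;
  src_surj : forall n (v : vertex n), exists e : edge n, src e = v ;
  rng_surj : forall n (v : vertex n.+1), exists e : edge n, rng e = v ;
  rng_finite : forall n (v : vertex n.+1), finite_set [set e : edge n | rng e = v]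
}.

Definition path_space (B : bratteli) : Type :=
  {x : forall n, edge B n | forall n, rng (x n) = src (x n.+1)}.

Lemma path_space_inhabited (B : bratteli) : exists x : path_space B, True.
Proof.
have [v _] : [set: vertex B 0] !=set0.
  exact: infinite_setN0 (vertex_infinite (b := B) (n := 0)).
have [e0 _] := src_surj v.
pose nxt n (e : edge B n) := projT1 (cid (src_surj (rng e))).
pose x : forall n, edge B n := nat_rect _ e0 nxt.
suff h n : rng (x n) = src (x n.+1) by exists (exist _ x h).
by rewrite /= /nxt; case: cid.
Qed.

(* A finite path starting in V_0, with the n.+1 edges p 0, ..., p n.  Paths
   without edges are left out: their cylinders are unions of cylinders of
   one-edge paths, and two of them with the same terminal vertex are equal. *)
Definition fin_path (B : bratteli) (n : nat) : Type :=
  {p : forall i : 'I_n.+1, edge B i |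
    forall i (h : (i.+1 < n.+1)%N),
      rng (p (Ordinal (ltnW h))) = src (p (Ordinal h))}.

Definition terminal (B : bratteli) (n : nat) (p : fin_path B n) :
  vertex B n.+1 := rng (sval p ord_max).

Definition cylinder (B : bratteli) (n : nat) (p : fin_path B n) :
  set (path_space B) :=
  [set x : path_space B | forall i : 'I_n.+1, sval x i = sval p i].

Definition cylinders (B : bratteli) : set (set (path_space B)) :=
  [set C | exists n (p : fin_path B n), C = cylinder p].

HB.instance Definition _ (B : bratteli) := gen_eqMixin (path_space B).
HB.instance Definition _ (B : bratteli) := gen_choiceMixin (path_space B).
HB.instance Definition _ (B : bratteli) :=
  isPointed.Build (path_space B) (projT1 (cid (path_space_inhabited B))).
HB.instance Definition _ (B : bratteli) :=
  @isSubBaseTopological.Build (path_space B) (set (path_space B))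
    (@cylinders B) id.

Definition borel_path_space (B : bratteli) :=
  g_sigma_algebraType (@open (path_space B)).
HB.instance Definition _ (B : bratteli) := Measurable.on (borel_path_space B).

Definition tail_invariant (B : bratteli) (R : realType)
    (mu : {measure set (borel_path_space B) -> \bar R}) : Prop :=
  forall n (p q : fin_path B n),
    terminal p = terminal q -> mu (cylinder p) = mu (cylinder q).

Section band_diagram.
Variable k : nat.

(* An edge is identified with the pair (source, range). *)
Definition band_edge : Type := {e : int * int | `|e.2 - e.1| <= k%:Z}.

Definition band_src (e : band_edge) : int := (sval e).1.
Definition band_rng (e : band_edge) : int := (sval e).2.

Lemma band_loop_subproof (v : int) : `|(v, v).2 - (v, v).1| <= k%:Z.
Proof. by rewrite /= subrr normr0. Qed.

Definition band_loop (v : int) : band_edge := exist _ (v, v) (band_loop_subproof v).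

Lemma band_src_surj (v : int) : exists e : band_edge, band_src e = v.
Proof. by exists (band_loop v). Qed.

Lemma band_rng_surj (v : int) : exists e : band_edge, band_rng e = v.
Proof. by exists (band_loop v). Qed.

Lemma int_infinite : infinite_set [set: int].
Proof.
move=> fin; apply: infinite_nat.
apply: (sub_finite_set (B := Posz @^-1` setT)) => //.
by apply: finite_preimage fin => a b _ _ [].
Qed.

Lemma band_rng_finite (v : int) : finite_set [set e | band_rng e = v].
Proof.
have inj : {in [set e | band_rng e = v] &, injective band_src}.
  move=> e f; rewrite !inE /= => ev fv ef; apply: val_inj => /=.
  by move: ev fv ef; rewrite /band_rng /band_src; case: (sval e) (sval f) => [? ?] [? ?] /= -> -> ->.
rewrite -(eq_finite_set (inj_card_eq inj)).
apply: (@sub_finite_set _ _ ((fun i : nat => v - k%:Z + i%:Z) @` `I_(k + k).+1)).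
  move=> _ [e /= ev <-]; have := valP e.
  move: ev; rewrite /band_rng /band_src /=; case: (sval e) => a b /= -> h.
  have := h; rewrite ler_norml => /andP[h1 h2].
  by exists (absz (a - v + k%:Z)) => /=; lia.
exact: finite_image (finite_II _).
Qed.

Lemma int_countable : countable [set: int].
Proof. exact: countableP. Qed.

Lemma band_edge_countable : countable [set: band_edge].
Proof. exact: countableP. Qed.

Definition band_diagram : bratteli :=
  @Bratteli (fun=> int) (fun=> band_edge) (fun=> band_src) (fun=> band_rng)
    (fun=> int_countable) (fun=> int_infinite) (fun=> band_edge_countable)
    (fun=> band_src_surj) (fun=> band_rng_surj) (fun=> band_rng_finite).

End band_diagram.

(* Main.v *)
Require Import Defs.
From mathcomp Require Import finmap.
From mathcomp Require Import all_boot all_order all_algebra.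
From mathcomp Require Import all_classical all_reals all_analysis.
From mathcomp Require Import zify ring lra.

(** Let mu be a tail invariant probability measure and let [mass n v] be the
    mu-measure of the set of paths whose n-th edge arrives at v.  Put
    d = 2k + 1.

    A finite path is determined by its last vertex v and its increments, and
    any increments between -k and k are possible ([track_cylinder]).  By tail
    invariance the d ^ (n + 1) cylinders of paths with n + 1 edges arriving at
    v all have measure mass n v / d ^ (n + 1) ([mu_arrives]).  Cutting one
    of them according to its next edge shows that mass n v is the average of
    mass (n + 1) over the d integers w with |w - v| <= k ([mass_average]).
    Seen backwards in time, the vertices thus perform a random walk on Z with
    bounded uniform steps, which has been running forever; such a walk is too
    spread out to carry a probability.

    The spreading is obtained from a maximum principle
    ([averaged_mass_eq0]).  Let M be the supremum of all the masses.  If an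
    average of d numbers bounded by M is within e of M, then each of them is
    within d * e of M.  Hence if mass n w is close enough to M, then
    after m more levels the vertices w, ..., w + m all have mass at
    least M / 2.  When M > 0 and m is large, their total mass exceeds 1.  So all
    masses vanish, while the sets of paths whose first edge arrives at a given
    vertex form a countable cover of the path space ([mass_neq0]). *)

Set Implicit Arguments.
Unset Strict Implicit.
Unset Printing Implicit Defensive.
Import Order.TTheory GRing.Theory Num.Theory.
Local Open Scope classical_set_scope.
Local Open Scope ring_scope.

(** * Averaging families of masses on the integers *)

Section averages.
Variables (R : realType) (k : nat) (a : nat -> int -> R).
Let d := (k + k).+1.
Hypothesis k_gt0 : (0 < k)%N.
Hypothesis avg : forall n w,
  d%:R * a n w = \sum_(j < d) a n.+1 (w + j%:Z - k%:Z).

(** The d - 1 other terms of the average contribute at most (d - 1) * M, so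
    the deficit of the remaining one is at most d times that of the average. *)
Lemma near_max_step (M e : R) (n : nat) (w : int) (j : 'I_d) :
  (forall n v, a n v <= M) -> M - e <= a n w ->
  M - d%:R * e <= a n.+1 (w + j%:Z - k%:Z).
Proof.
move=> aM Me.
have d0 : (0 : R) < d%:R by rewrite ltr0n.
have := avg n w; rewrite (bigD1 j) //= => E.
have S : \sum_(i < d | i != j) a n.+1 (w + i%:Z - k%:Z) <= (d.-1)%:R * M.
  apply: le_trans (ler_sum _ (fun i _ => aM _ _)) _.
  by rewrite sumr_const cardC1 card_ord mulr_natl.
have : d%:R * (M - e) <= d%:R * a n w by rewrite ler_pM2l.
rewrite E mulrBr => H.
have dE : d%:R = (d.-1)%:R + 1 :> R by rewrite natr1.
move: H; rewrite {1}dE mulrDl mul1r; lra.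
Qed.

(** Only the offsets 0 and 1 among the steps between -k and k are used: m of
    them lead from w to each of w, ..., w + m.  This is where k > 0 enters. *)
Lemma near_max_propagate (M e : R) (n m : nat) (w : int) (j : nat) :
  (forall n v, a n v <= M) -> M - e <= a n w -> (j <= m)%N ->
  M - d%:R ^+ m * e <= a (n + m)%N (w + j%:Z).
Proof.
move=> aM Me; elim: m j => [|m IH] j jm.
  by move: jm; rewrite leqn0 => /eqP->; rewrite addr0 addn0 expr0 mul1r.
rewrite addnS exprS -mulrA.
have [jm'|mj] := leqP j m.
  (* The offset is j - k, hence the index k stands for the step 0. *)
  have kd : (k < d)%N by rewrite /d; lia.
  have := near_max_step (Ordinal kd) aM (IH _ jm').
  by rewrite /= addrK.
have -> : j = m.+1 by lia.
have kd : (k.+1 < d)%N by rewrite /d; lia.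
have := near_max_step (Ordinal kd) aM (IH _ (leqnn m)).
by rewrite /= (_ : w + m%:Z + k.+1%:Z - k%:Z = w + m.+1%:Z) //; lia.
Qed.

(** The maximum principle: a near maximal value forces near maximal values on
    arbitrarily long intervals of a later level, whose total mass is bounded. *)
Lemma averaged_mass_eq0 :
  (forall n v, 0 <= a n v) ->
  (forall n w m, \sum_(j < m) a n (w + j%:Z) <= 1) ->
  forall n v, a n v = 0.
Proof.
move=> a0 a1 n v; apply/eqP/negPn/negP => anv.
have le1 n' v' : a n' v' <= 1.
  by have := a1 n' v' 1%N; rewrite big_ord1 addr0.
pose A := range (fun p : nat * int => a p.1 p.2).
have hA : has_sup A.
  split; first by exists (a n v), (n, v).
  by exists 1 => _ [p _ <-].
pose M := sup A.
have aM n' v' : a n' v' <= M.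
  by apply: ub_le_sup; [exact: hA.2|exists (n', v')].
have M0 : 0 < M by apply: lt_le_trans (aM n v); rewrite lt_def anv a0.
pose m := Num.bound (2 / M).
have mM : 2 < m%:R * M.
  by rewrite -ltr_pdivrMr //; apply: archi_boundP; rewrite divr_ge0 // ltW.
(* Chosen so that the deficit d ^ m * e after m levels is M / 2. *)
pose e := M / (2 * d%:R ^+ m).
have dm : (0 : R) < d%:R ^+ m by rewrite exprn_gt0 // ltr0n.
have e0 : 0 < e by rewrite divr_gt0 // mulr_gt0.
have [_ [[n' w] _ <-] /= /ltW Me] := sup_adherent e0 hA.
have := a1 (n' + m)%N w m.
apply/negP; rewrite -ltNge.
apply: (@lt_le_trans _ _ (\sum_(j < m) (M / 2))).
  by rewrite sumr_const card_ord -mulr_natl; lra.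
apply: ler_sum => j _.
have := near_max_propagate aM Me (ltnW (ltn_ord j)).
congr (_ <= _).
rewrite /e; field; lra.
Qed.
End averages.

(** * Paths of the band diagram and their increments *)

Section paths.
Variable k : nat.
Notation d := (k + k).+1.
Notation X := (borel_path_space (band_diagram k)).

Definition arrival (x : X) (n : nat) : int := band_rng (sval x n).

Definition departure (x : X) (n : nat) : int := band_src (sval x n).

Lemma arrivalE (x : X) n : arrival x n = departure x n.+1.
Proof. exact: (svalP x n). Qed.

Lemma step_bound (x : X) n : `|arrival x n - departure x n| <= k%:Z.
Proof. exact: (valP (sval x n)). Qed.

Definition arrives (n : nat) (v : int) : set X := [set x | arrival x n = v].

(** A finite path is encoded by its last vertex and its increments, shifted
    by k so as to range over ['I_d]: this makes the paths that end at a given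
    vertex a product set.  The sequence s is infinite, but only its first n + 1
    terms matter, so that extending a path needs no change of type. *)
Definition track (n : nat) (v : int) (s : nat -> 'I_d) : set X :=
  [set x | arrival x n = v /\
    forall i, (i <= n)%N -> arrival x i = departure x i + (s i)%:Z - k%:Z].

Definition walk (u : int) (s : nat -> 'I_d) (i : nat) : int :=
  u + \sum_(j < i) ((s j)%:Z - k%:Z).

Lemma walkS u s i : walk u s i.+1 = walk u s i + (s i)%:Z - k%:Z.
Proof. by rewrite /walk big_ord_recr /= !addrA. Qed.

Lemma walk_step u s i : `|(walk u s i, walk u s i.+1).2 -
  (walk u s i, walk u s i.+1).1| <= k%:Z.
Proof. by rewrite /= walkS; have := ltn_ord (s i); lia. Qed.

Definition walk_edge u s i : band_edge k :=
  exist _ (walk u s i, walk u s i.+1) (walk_step u s i).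

Lemma walk_edge_chain n u s i (h : (i.+1 < n.+1)%N) :
  band_rng (walk_edge u s (Ordinal (ltnW h))) =
  band_src (walk_edge u s (Ordinal h)).
Proof. by []. Qed.

Definition walk_path n u s : fin_path (band_diagram k) n :=
  exist _ (fun i : 'I_n.+1 => walk_edge u s i) (@walk_edge_chain n u s).

(** The start of the path is recovered by subtracting all the increments from
    its end v. *)
Lemma track_cylinder n (v : int) s :
  exists p : fin_path (band_diagram k) n,
    terminal p = v /\ track n v s = cylinder p.
Proof.
pose u := v - \sum_(j < n.+1) ((s j)%:Z - k%:Z).
have wv : walk u s n.+1 = v by rewrite /walk subrK.
exists (walk_path n u s); split; first exact: wv.
apply/seteqP; split => x /=.
- move=> [xv xs] [i /=]; rewrite ltnS => ilen.
  (* The end is what is known about x, so its vertices are found backwards. *)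
  have H m : (m <= n)%N -> arrival x (n - m) = walk u s (n - m).+1.
    elim: m => [_|m IH mn]; first by rewrite subn0 xv wv.
    have E : (n - m = (n - m.+1).+1)%N by lia.
    have := xs (n - m)%N (leq_subr _ _); rewrite IH; last lia.
    by rewrite E -arrivalE walkS; lia.
  have := H (n - i)%N (leq_subr _ _); rewrite subKn // => Hi.
  have := xs i ilen; rewrite Hi walkS => Hd.
  apply: val_inj => /=.
  rewrite [LHS]surjective_pairing; congr (_, _); last exact: Hi.
  by rewrite -[LHS]/(departure x i); lia.
- move=> H.
  have Ha i : (i <= n)%N -> arrival x i = walk u s i.+1.
    by move=> ilen; rewrite /arrival (H (Ordinal (ilen : (i < n.+1)%N))).
  have Hd i : (i <= n)%N -> departure x i = walk u s i.
    by move=> ilen; rewrite /departure (H (Ordinal (ilen : (i < n.+1)%N))).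
  by split=> [|i ilen]; rewrite ?Ha ?Hd // walkS.
Qed.

(** Cylinders belong to the subbase of the topology, hence are open. *)
Lemma measurable_cylinder (B : bratteli) n (p : fin_path B n) :
  measurable (cylinder p : set (borel_path_space B)).
Proof.
apply: sub_sigma_algebra.
exists [set cylinder p]; last by rewrite bigcup_set1.
move=> _ ->; exists (fset1 (cylinder p : set (path_space B))).
  by move=> C; rewrite in_fset1 => /eqP ->; apply/mem_set; exists n, p.
by rewrite set_fset1 bigcap_set1.
Qed.

Lemma measurable_track n v s : measurable (track n v s).
Proof.
have [p [_ ->]] := track_cylinder n v s; exact: measurable_cylinder.
Qed.

Lemma track_split n v s : track n v s =
  \bigcup_(j in [set: 'I_d])
    track n.+1 (v + j%:Z - k%:Z) (fun i => if (i <= n)%N then s i else j).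
Proof.
apply/seteqP; split => x.
- move=> [xv xs].
  have xb := step_bound x n.+1.
  have b : (absz (arrival x n.+1 - departure x n.+1 + k%:Z)%R < d)%N by lia.
  exists (Ordinal b) => //=; rewrite -xv arrivalE; split => /=.
    by lia.
  move=> i; rewrite leq_eqVlt => /predU1P[->|].
    by rewrite ltnn /=; lia.
  by rewrite ltnS => h; rewrite h xs.
- move=> [j _ [xv xs]]; split.
    by have := xs n.+1 (leqnn _); rewrite ltnn xv -arrivalE; lia.
  by move=> i h; have := xs i (leqW h); rewrite h.
Qed.

Lemma arrives_tracks n v : arrives n v =
  \bigcup_(f in [set: {ffun 'I_n.+1 -> 'I_d}]) track n v (fun i => f (inord i)).
Proof.
apply/seteqP; split => x; last by move=> [f _ []].
move=> xv.
exists [ffun i : 'I_n.+1 => inord (absz (arrival x i - departure x i + k%:Z))] => //.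
split=> // i ilen; have xb := step_bound x i.
by rewrite ffunE inordK // inordK; lia.
Qed.

Lemma measurable_arrives n v : measurable (arrives n v).
Proof.
rewrite arrives_tracks; apply: fin_bigcup_measurable; first exact: finite_finset.
by move=> f _; exact: measurable_track.
Qed.
End paths.

(** * Consequences of tail invariance *)

Lemma measure_bigcup_finType d (T : measurableType d) (R : realType)
    (mu : {measure set T -> \bar R}) (I : finType) (F : I -> set T) :
  (forall i, measurable (F i)) -> trivIset setT F ->
  mu (\bigcup_(i in [set: I]) F i) = (\sum_i mu (F i))%E.
Proof.
move=> mF tF; rewrite measure_fin_bigcup //; last exact: finite_finset.
rewrite [RHS]fsbig_seq ?index_enum_uniq //.
apply: eq_fsbigl.
by apply/seteqP; split=> i //= _; rewrite mem_index_enum.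
Qed.

Section invariant_probability.
Variables (R : realType) (k : nat).
Notation d := (k + k).+1.
Notation X := (borel_path_space (band_diagram k)).
Variable mu : probability X R.
Hypothesis mu_inv : tail_invariant mu.

Lemma mu_track n v s t : mu (track n v s) = mu (track n v t).
Proof.
have [p [pv ->]] := track_cylinder n v s.
have [q [qv ->]] := track_cylinder n v t.
by apply: mu_inv; rewrite pv qv.
Qed.

(** The extensions of the path by one edge have different increments, but by
    tail invariance only their last vertices matter; so the same s may be kept
    on the right-hand side. *)
Lemma mu_trackS n v s :
  mu (track n v s) = (\sum_(j < d) mu (track n.+1 (v + j%:Z - k%:Z) s))%E.
Proof.
rewrite track_split measure_bigcup_finType.
- by apply: eq_bigr => j _; exact: mu_track.
- by move=> j; exact: measurable_track.
- move=> i j _ _ [x [[xi _] [xj _]]]; apply: val_inj => /=.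
  by move: xj; rewrite xi; lia.
Qed.

(** There are d choices for each of the n + 1 increments of a path to v. *)
Lemma mu_arrives n v s :
  mu (arrives n v) = ((d ^ n.+1)%:R%:E * mu (track n v s))%E.
Proof.
rewrite arrives_tracks measure_bigcup_finType.
- rewrite (eq_bigr _ (fun f _ => mu_track n v _ s)) sumr_const.
  by rewrite card_ffun !card_ord mule_natl.
- by move=> j; exact: measurable_track.
- move=> f g _ _ [x [[_ xf] [_ xg]]]; apply/ffunP => i.
  have := xf i (ltn_ord i); rewrite xg ?inord_val; last exact: (ltn_ord i).
  by move=> H; apply: val_inj => /=; lia.
Qed.

Definition mass n v : R := fine (mu (arrives n v)).

Lemma massE n v : (mass n v)%:E = mu (arrives n v).
Proof.
rewrite /mass fineK //; apply: fin_num_measure; exact: measurable_arrives.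
Qed.

(** Multiplying the measures of the tracks at two consecutive levels by the
    number of tracks turns the sum of [mu_trackS] into an average. *)
Lemma mass_average n v :
  d%:R * mass n v = \sum_(j < d) mass n.+1 (v + j%:Z - k%:Z).
Proof.
pose s (_ : nat) : 'I_d := ord0.
apply: EFin_inj; rewrite EFinM massE (mu_arrives n v s) mu_trackS -sumEFin.
rewrite muleA -EFinM -natrM -expnS ge0_sume_distrr //.
by apply: eq_bigr => j _; rewrite massE (mu_arrives _ _ s).
Qed.

Lemma mass_sum_le1 n w m : \sum_(j < m) mass n (w + j%:Z) <= 1.
Proof.
rewrite -lee_fin -sumEFin (eq_bigr _ (fun j _ => massE n _)).
rewrite -measure_bigcup_finType.
- apply: probability_le1; apply: fin_bigcup_measurable; first exact: finite_finset.
  by move=> j _; exact: measurable_arrives.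
- by move=> j; exact: measurable_arrives.
- move=> i j _ _ [x []]; rewrite /arrives /= => xi xj.
  by apply: val_inj => /=; lia.
Qed.

(** Countably many null sets cannot cover a probability space. *)
Lemma mass_neq0 : ~ forall v, mass 0 v = 0.
Proof.
move=> m0.
have : mu.-negligible [set: X].
  pose F i : set X := if @unpickle int i is Some v then arrives 0 v else set0.
  have -> : [set: X] = \bigcup_i F i.
    apply/seteqP; split=> // x _; exists (pickle (arrival x 0)) => //.
    by rewrite /F pickleK.
  apply: negligible_bigcup => i; rewrite /F.
  case: unpickle => [v|]; last exact: negligible_set0.
  apply/negligibleP; first exact: measurable_arrives.
  exact: etrans (esym (massE 0 v)) (congr1 EFin (m0 v)).
move/negligibleP => /(_ measurableT) mu0.
have /eqP := etrans (esym (probability_setT mu)) mu0.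
by rewrite onee_eq0.
Qed.
End invariant_probability.

Theorem proposition6p4 (R : realType) (k : nat) (hk : (1 <= k)%N) :
  ~ exists mu : probability (borel_path_space (band_diagram k)) R,
      tail_invariant mu.
Proof.
move=> [mu inv]; apply: (@mass_neq0 R k mu) => v.
apply: (averaged_mass_eq0 hk (mass_average inv)).
- by move=> n w; rewrite /mass fine_ge0.
- exact: mass_sum_le1.
Qed.
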